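(* Let $A, B, C, D$ be four non-overlapping unit balls in $\mathbb{R}^d$ with centers $a, b, c, d$, respectively. If they have a line transversal with the order $ABCD$ (that is, a line transversal which, suitably oriented, meets $A$ first, then $B$, then $C$, then $D$), then $|ad| > \max\{|ab|, |bc|, |cd|\}$.
   Context: A unit ball is a closed ball of radius one. A family of balls is non-overlapping if its members have pairwise disjoint interiors (they may touch). A line transversal to a non-overlapping family is a line that intersects every member of the family and that is not tangent to two touching members at their common point of contact (equivalently, common points of contact are removed from the sets, which makes them pairwise disjoint). An oriented line transversal induces a linear order on the family, namely the order in which it meets the balls ($X$ comes before $Y$ if and only if $\vec{v}\cdot (y-x) > 0$, where $\vec{v}$ is the direction of the line and $x,y$ are the centers). $|pq|$ denotes the Euclidean distance between points $p$ and $q$. *)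

(* Defs.v *)
From HB Require Import structures.
From mathcomp Require Import all_boot all_order all_algebra.
From mathcomp Require Import boolp classical_sets reals topology normedtype.

Set Implicit Arguments.
Unset Strict Implicit.
Unset Printing Implicit Defensive.

Import Order.TTheory GRing.Theory Num.Theory.
Import numFieldTopology.Exports.

Local Open Scope classical_set_scope.
Local Open Scope ring_scope.

Definition dot (R : realType) (d : nat) (u v : 'rV[R]_d) : R :=
  (u *m v^T) 0 0.

(* The norm the library puts on row vectors is the sup norm, hence the
   separate Euclidean distance.  The topologies agree, so the library's
   interior can be used below. *)
Definition edist (R : realType) (d : nat) (p q : 'rV[R]_d) : R :=
  Num.sqrt (dot (p - q) (p - q)).

Definition unit_ball (R : realType) (d : nat) (c : 'rV[R]_d) : set 'rV[R]_d :=
  [set x | edist c x <= 1].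

(* Families are indexed, so that repeating a member is an overlap. *)
Definition nonoverlapping (R : realType) (d : nat) (I : Type)
    (F : I -> set 'rV[R]_d) : Prop :=
  trivIset setT (fun i => interior (F i)).

Definition line (R : realType) (d : nat) (p v : 'rV[R]_d) : set 'rV[R]_d :=
  [set p + t *: v | t in [set: R]].

(* Meant for a line l and a ball X. *)
Definition tangent_at (R : realType) (d : nat) (x : 'rV[R]_d)
    (l X : set 'rV[R]_d) : Prop :=
  l `&` X = [set x].

Definition line_transversal (R : realType) (d : nat) (I : Type)
    (l : set 'rV[R]_d) (F : I -> set 'rV[R]_d) : Prop :=
  (forall i, l `&` F i !=set0) /\
  (forall i j x, i <> j -> F i x -> F j x ->
     ~ (tangent_at x l (F i) /\ tangent_at x l (F j))).

(* For disjoint unit balls centered at x and y, this says that a line directed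
   by v meeting both of them meets the first one first. *)
Definition precedes (R : realType) (d : nat) (v x y : 'rV[R]_d) : bool :=
  0 < dot v (y - x).

Definition has_transversal_in_order (R : realType) (d n : nat)
    (c : n.-tuple 'rV[R]_d) : Prop :=
  exists p v : 'rV[R]_d,
    [/\ v != 0,
        line_transversal (line p v) (fun i => unit_ball (tnth c i))
      & forall i j : 'I_n, (i < j)%N -> precedes v (tnth c i) (tnth c j)].

(* Main.v *)
(** Split each center into its coordinate along the line and a component
    [a, b, c, d] orthogonal to it; the orthogonal components have norm at most
    1.  Let [p, q, r > 0] be the gaps between consecutive coordinates.  The
    parallelogram law turns [|AB| >= 2] into
    [|a+b|^2 <= p^2 - 2(1-|a|^2) - 2(1-|b|^2)], and similarly for BC and CD.
    With [w = a+b], [Q = b+c], [S = c+d], both [|AD|^2 - |AB|^2] and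
    [|AD|^2 - |BC|^2] are at least
    [2(pr - w.S) + 2(pq + w.Q) + 2(qr + Q.S) + 4(1-|b|^2) + 4(1-|c|^2)],
    whose terms are nonnegative by Cauchy-Schwarz.  The case of CD follows by
    reversing the line. *)

From mathcomp Require Import all_boot all_order all_algebra.
From mathcomp Require Import boolp classical_sets reals topology normedtype.
From mathcomp Require Import ring lra.
Require Import Defs.

Import Order.TTheory GRing.Theory Num.Theory.
Import numFieldTopology.Exports numFieldNormedType.Exports.
Local Open Scope classical_set_scope.
Local Open Scope ring_scope.

Lemma dotE {R : realType} {n} (x y : 'rV[R]_n) :
  dot x y = \sum_i x 0 i * y 0 i.
Proof. by rewrite /dot mxE; apply: eq_bigr => i _; rewrite mxE. Qed.

Lemma dotC {R : realType} {n} (x y : 'rV[R]_n) : dot x y = dot y x.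
Proof. by rewrite !dotE; apply: eq_bigr => i _; rewrite mulrC. Qed.

Lemma dotDl {R : realType} {n} (x y z : 'rV[R]_n) :
  dot (x + y) z = dot x z + dot y z.
Proof. by rewrite /dot mulmxDl mxE. Qed.

Lemma dotNl {R : realType} {n} (x z : 'rV[R]_n) : dot (- x) z = - dot x z.
Proof. by rewrite /dot mulNmx mxE. Qed.

Lemma dotZl {R : realType} {n} k (x z : 'rV[R]_n) : dot (k *: x) z = k * dot x z.
Proof. by rewrite /dot -scalemxAl mxE. Qed.

Lemma dotDr {R : realType} {n} (x y z : 'rV[R]_n) :
  dot z (x + y) = dot z x + dot z y.
Proof. by rewrite ![dot z _]dotC dotDl. Qed.

Lemma dotNr {R : realType} {n} (x z : 'rV[R]_n) : dot z (- x) = - dot z x.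
Proof. by rewrite ![dot z _]dotC dotNl. Qed.

Lemma dotZr {R : realType} {n} k (x z : 'rV[R]_n) : dot z (k *: x) = k * dot z x.
Proof. by rewrite ![dot z _]dotC dotZl. Qed.

Definition dotLE :=
  (@dotDl, @dotDr, @dotNl, @dotNr, @dotZl, @dotZr).

Lemma dot_ge0 {R : realType} {n} (x : 'rV[R]_n) : 0 <= dot x x.
Proof. by rewrite dotE sumr_ge0 // => i _; rewrite -expr2 sqr_ge0. Qed.

Lemma dot_eq0 {R : realType} {n} (x : 'rV[R]_n) : (dot x x == 0) = (x == 0).
Proof.
apply/eqP/eqP => [|->]; last by rewrite dotE big1 // => i _; rewrite mxE mul0r.
rewrite dotE => /psumr_eq0P x0; apply/rowP => i; rewrite mxE.
apply/eqP; rewrite -[_ == 0]orbb -mulf_eq0 x0 // => j _.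
by rewrite -expr2 sqr_ge0.
Qed.

(** Cauchy-Schwarz with bounds in place of norms: expand [|q x - p y|^2 >= 0] and divide by
    [2pq]. *)
Lemma dot_le_mul {R : realType} {n} {x y : 'rV[R]_n} {p q : R} :
  0 < p -> 0 < q -> dot x x <= p ^+ 2 -> dot y y <= q ^+ 2 ->
  dot x y <= p * q.
Proof.
move=> p0 q0 xp yq.
have := dot_ge0 (q *: x - p *: y); rewrite !dotLE (dotC y x) => H.
have pq0 : 0 < p * q by rewrite mulr_gt0.
have Hx : q ^+ 2 * dot x x <= q ^+ 2 * p ^+ 2 by rewrite ler_wpM2l ?sqr_ge0.
have Hy : p ^+ 2 * dot y y <= p ^+ 2 * q ^+ 2 by rewrite ler_wpM2l ?sqr_ge0.
rewrite -(ler_pM2l pq0); lra.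
Qed.

Lemma dot_ge_Nmul {R : realType} {n} {x y : 'rV[R]_n} {p q : R} :
  0 < p -> 0 < q -> dot x x <= p ^+ 2 -> dot y y <= q ^+ 2 ->
  - (p * q) <= dot x y.
Proof.
move=> p0 q0 xp yq; rewrite lerNl -dotNl dot_le_mul //.
by rewrite dotNl dotNr opprK.
Qed.

(* Equality in Cauchy-Schwarz would make [x + y] and [y + z] antiparallel,
   although both have positive inner product with the unit vector [y]. *)
Lemma dot_sum_gt_Nmul {R : realType} {n} {x y z : 'rV[R]_n} {p q : R} :
  0 < p -> 0 < q -> dot x x <= 1 -> dot z z <= 1 -> dot y y = 1 ->
  dot (x + y) (x + y) <= p ^+ 2 -> dot (y + z) (y + z) <= q ^+ 2 ->
  - (p * q) < dot (x + y) (y + z).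
Proof.
move=> p0 q0 x1 z1 y1 wp zq; rewrite lt_neqAle dot_ge_Nmul // andbT.
apply/eqP => E.
have pq0 : 0 < p * q by rewrite mulr_gt0.
(* Since [|x| <= 1 = |y|], [|x + y|^2 <= 2 (x + y).y]; and [x + y] is nonzero, as otherwise [E]
   would give [pq = 0]. *)
have wy : 0 < dot (x + y) y.
  have : dot (x + y) (x + y) != 0.
    rewrite dot_eq0; apply/eqP => w0.
    by move: E pq0; rewrite w0 -(scale0r 0) dotZl; lra.
  have := dot_ge0 (x + y).
  by rewrite le_eqVlt eq_sym => /orP[->//|]; rewrite !dotLE (dotC y x); lra.
have Qy : 0 <= dot (y + z) y.
  by have := dot_ge0 (y + z); rewrite !dotLE (dotC y z); lra.
(* By [E] the cross term is [-2 p^2 q^2], which cancels the bounds on the two squares. *)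
have : q *: (x + y) + p *: (y + z) == 0.
  rewrite -dot_eq0 eq_le dot_ge0 andbT.
  rewrite !(dotDl (q *: _), dotDr (q *: _), dotZl, dotZr).
  rewrite (dotC (y + z) (x + y)) -E.
  have Hx : q ^+ 2 * dot (x + y) (x + y) <= q ^+ 2 * p ^+ 2.
    by rewrite ler_wpM2l ?sqr_ge0.
  have Hy : p ^+ 2 * dot (y + z) (y + z) <= p ^+ 2 * q ^+ 2.
    by rewrite ler_wpM2l ?sqr_ge0.
  lra.
move=> /eqP/(congr1 (fun t => dot t y)).
rewrite !(dotDl (q *: _), dotZl) -[in RHS](scale0r 0) dotZl mul0r => H.
have : 0 < q * dot (x + y) y by rewrite mulr_gt0.
have : 0 <= p * dot (y + z) y by rewrite mulr_ge0 // ltW.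
lra.
Qed.

(* [x] and [y] are the components orthogonal to the line, and [p] is the
   distance along the line, of the centers of two non-overlapping balls. *)
Lemma parallelogram_gap {R : realType} {n} {x y : 'rV[R]_n} {p : R} :
  4 <= p ^+ 2 + dot (x - y) (x - y) ->
  dot (x + y) (x + y) <= p ^+ 2 - 2 * (1 - dot x x) - 2 * (1 - dot y y).
Proof. by rewrite !dotLE (dotC y x); lra. Qed.

(** Here [a], [b], [c], [d] are the orthogonal components, so [p ^+ 2 + dot (a - b) (a - b)] and its
    analogues are squared distances between centers. *)
Lemma four_balls_coord {R : realType} {n} {a b c d : 'rV[R]_n} {p q r : R} :
  0 < p -> 0 < q -> 0 < r ->
  dot a a <= 1 -> dot b b <= 1 -> dot c c <= 1 -> dot d d <= 1 ->
  4 <= p ^+ 2 + dot (a - b) (a - b) ->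
  4 <= q ^+ 2 + dot (b - c) (b - c) ->
  4 <= r ^+ 2 + dot (c - d) (c - d) ->
  p ^+ 2 + dot (a - b) (a - b) < (p + q + r) ^+ 2 + dot (a - d) (a - d) /\
  q ^+ 2 + dot (b - c) (b - c) < (p + q + r) ^+ 2 + dot (a - d) (a - d).
Proof.
move=> p0 q0 r0 a1 b1 c1 d1.
move=> /parallelogram_gap gab /parallelogram_gap gbc /parallelogram_gap gcd.
have wp : dot (a + b) (a + b) <= p ^+ 2 by lra.
have Qq : dot (b + c) (b + c) <= q ^+ 2 by lra.
have Sr : dot (c + d) (c + d) <= r ^+ 2 by lra.
have wS := dot_le_mul p0 r0 wp Sr.
have QS := dot_ge_Nmul q0 r0 Qq Sr.
have wQ := dot_ge_Nmul p0 q0 wp Qq.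
(* Strictness of the conclusion comes from here: either [1 - |b|^2] is positive, or [|b| = 1] and
   Cauchy-Schwarz is strict. *)
have pos : 0 < (p * q + dot (a + b) (b + c)) + 2 * (1 - dot b b).
  have [b1E|nb1] := eqVneq (dot b b) 1.
    by have := dot_sum_gt_Nmul p0 q0 a1 c1 b1E wp Qq; lra.
  have : dot b b < 1 by rewrite lt_neqAle nb1.
  lra.
move: gab gbc gcd wS QS pos {wQ wp Qq Sr}; rewrite !dotLE.
rewrite (dotC b a) (dotC d a) (dotC c b) (dotC d c).
by move=> *; split; lra.
Qed.

Lemma edist2 {R : realType} {n} (x y : 'rV[R]_n) :
  edist x y ^+ 2 = dot (x - y) (x - y).
Proof. by rewrite sqr_sqrtr ?dot_ge0. Qed.

Lemma edist_lt {R : realType} {n} (x y z t : 'rV[R]_n) :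
  (edist x y < edist z t) = (dot (x - y) (x - y) < dot (z - t) (z - t)).
Proof. by rewrite -!edist2 ltr_pXn2r // nnegrE sqrtr_ge0. Qed.

(** The squared distance to [c] is a polynomial in the coordinates, hence continuous, so the strict
    inequality persists near [x]. *)
Lemma unit_ball_interior {R : realType} {n} (c x : 'rV[R]_n) :
  dot (c - x) (c - x) < 1 -> interior (unit_ball c) x.
Proof.
move=> cx.
have cont : continuous (fun y : 'rV[R]_n => dot (c - y) (c - y)).
  have -> : (fun y => dot (c - y) (c - y)) =
      (fun y => \sum_i (c - y) 0 i * (c - y) 0 i).
    by apply/funext => y; rewrite dotE.
  have ci i : continuous (fun y : 'rV[R]_n => (c - y) 0 i).
    have -> : (fun y => (c - y) 0 i) = (fun y : 'rV[R]_n => c 0 i - y 0 i).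
      by apply/funext => y; rewrite !mxE.
    move=> y; apply: (@cvgB _ _ _ _ (nbhs_filter y)); first exact: cvg_cst.
    exact: coord_continuous.
  apply: continuous_big => [|i _ y]; first exact: add_continuous.
  exact: (@cvgM _ _ _ (nbhs_filter y) _ _ _ _ (ci i y) (ci i y)).
have : \forall y \near x, dot (c - y) (c - y) < 1.
  exact: (cont x _ (lt_nbhsl cx)).
apply: filterS => y cy; rewrite /unit_ball /= -(@ler_pXn2r _ 2) ?nnegrE ?sqrtr_ge0 //.
by rewrite edist2 expr1n ltW.
Qed.

(** If the centers were closer than 2, their midpoint would be interior to both balls. *)
Lemma unit_balls_dist {R : realType} {n} (x y : 'rV[R]_n) :
  interior (unit_ball x) `&` interior (unit_ball y) = set0 ->
  4 <= dot (x - y) (x - y).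
Proof.
move=> E; rewrite leNgt; apply/negP => xy.
suff : set0 (2^-1 *: (x + y)) by [].
rewrite -E; split; apply: unit_ball_interior.
- have -> : x - 2^-1 *: (x + y) = 2^-1 *: (x - y).
    by apply/rowP => i; rewrite !mxE; field.
  by rewrite dotZl dotZr; lra.
- have -> : y - 2^-1 *: (x + y) = - 2^-1 *: (x - y).
    by apply/rowP => i; rewrite !mxE; field.
  by rewrite dotZl dotZr; lra.
Qed.

(** Orthogonal projection along [v], which need not have length 1. *)
Definition perp {R : realType} {n} (v x : 'rV[R]_n) : 'rV[R]_n :=
  x - (dot v x / dot v v) *: v.

Lemma dot_perp {R : realType} {n} (v x : 'rV[R]_n) : v != 0 ->
  dot x x = (dot v x / Num.sqrt (dot v v)) ^+ 2 + dot (perp v x) (perp v x).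
Proof.
rewrite -dot_eq0 => v0; rewrite exprMn exprVn sqr_sqrtr ?dot_ge0 //.
by rewrite !dotLE (dotC x v); field.
Qed.

Lemma perpB {R : realType} {n} (v x y : 'rV[R]_n) :
  perp v (x - y) = perp v x - perp v y.
Proof.
by apply/rowP => i; rewrite /perp !mxE !dotLE; ring.
Qed.

Lemma perp_line {R : realType} {n} (v x : 'rV[R]_n) t : v != 0 ->
  perp v (x - t *: v) = perp v x.
Proof.
rewrite -dot_eq0 => v0.
by apply/rowP => i; rewrite /perp !mxE !dotLE; field.
Qed.

(** [perp v] sends the whole line to one point and does not lengthen vectors. *)
Lemma line_meets_unit_ball {R : realType} {n} {p v x : 'rV[R]_n} : v != 0 ->
  line p v `&` unit_ball x !=set0 -> dot (perp v (x - p)) (perp v (x - p)) <= 1.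
Proof.
move=> v0 [_ [[t _ <-]]]; rewrite /unit_ball /= => H.
have : dot (x - (p + t *: v)) (x - (p + t *: v)) <= 1.
  by rewrite -edist2 expr_le1 ?sqrtr_ge0.
rewrite opprD addrA (dot_perp v) // perp_line //.
by apply: le_trans; rewrite lerDr sqr_ge0.
Qed.

Theorem mainTheorem2 (R : realType) (n : nat) (a b c d : 'rV[R]_n)
  (hno : nonoverlapping (fun i => unit_ball (tnth [tuple a; b; c; d] i)))
  (htr : has_transversal_in_order [tuple a; b; c; d]) :
  Num.max (Num.max (edist a b) (edist b c)) (edist c d) < edist a d.
Proof.
have [p [v [v0 [hit _] ord]]] := htr.
pose i0 : 'I_4 := @Ordinal 4 0 isT; pose i1 : 'I_4 := @Ordinal 4 1 isT.
pose i2 : 'I_4 := @Ordinal 4 2 isT; pose i3 : 'I_4 := @Ordinal 4 3 isT.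
have far i j : i != j -> 4 <= dot (tnth [tuple a; b; c; d] i - tnth [tuple a; b; c; d] j)
    (tnth [tuple a; b; c; d] i - tnth [tuple a; b; c; d] j).
  move=> ij; apply: unit_balls_dist.
  by have /trivIsetP/(_ i j I I ij) := hno.
have fab : 4 <= dot (a - b) (a - b) := far i0 i1 isT.
have fbc : 4 <= dot (b - c) (b - c) := far i1 i2 isT.
have fcd : 4 <= dot (c - d) (c - d) := far i2 i3 isT.
have hu i := line_meets_unit_ball v0 (hit i).
pose s x := dot v x / Num.sqrt (dot v v).
pose u x := perp v (x - p).
have ua : dot (u a) (u a) <= 1 := hu i0.
have ub : dot (u b) (u b) <= 1 := hu i1.
have uc : dot (u c) (u c) <= 1 := hu i2.
have ud : dot (u d) (u d) <= 1 := hu i3.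
have v0' : 0 < Num.sqrt (dot v v).
  by rewrite sqrtr_gt0 lt_neqAle eq_sym dot_eq0 v0 dot_ge0.
have spos x y : precedes v x y -> 0 < s y - s x.
  by rewrite /precedes /s -mulrBl dotDr dotNr => H; rewrite divr_gt0.
have p0 : 0 < s b - s a by apply: spos; exact: (ord i0 i1 isT).
have q0 : 0 < s c - s b by apply: spos; exact: (ord i1 i2 isT).
have r0 : 0 < s d - s c by apply: spos; exact: (ord i2 i3 isT).
(* Pythagoras; the base point [p] of the line cancels in the difference. *)
have dE x y : dot (x - y) (x - y) = (s y - s x) ^+ 2 + dot (u x - u y) (u x - u y).
  rewrite (dot_perp v) // /u -perpB.
  have -> : x - p - (y - p) = x - y by apply/rowP => i; rewrite !mxE; ring.
  by congr (_ + _); rewrite /s -mulrBl -[LHS]sqrrN -mulNr dotDr dotNr opprB.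
have dC (x y : 'rV[R]_n) : dot (x - y) (x - y) = dot (y - x) (y - x).
  by rewrite -opprB dotNl dotNr opprK.
have sE : s b - s a + (s c - s b) + (s d - s c) = s d - s a by ring.
have sE' : s d - s c + (s c - s b) + (s b - s a) = s d - s a by ring.
rewrite (dE a b) in fab; rewrite (dE b c) in fbc; rewrite (dE c d) in fcd.
rewrite !gt_max !edist_lt (dE a b) (dE b c) (dE c d) (dE a d).
have [Hab Hbc] := four_balls_coord p0 q0 r0 ua ub uc ud fab fbc fcd.
rewrite -sE Hab Hbc sE -sE' /=.
(* For CD, the order [d, c, b, a] has gaps [r, q, p], and the first conclusion of [four_balls_coord]
   is the claim up to the sign of differences. *)
rewrite (dC (u c)) (dC (u a)).
by have [] := four_balls_coord r0 q0 p0 ud uc ub ua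
  ltac:(by rewrite dC) ltac:(by rewrite dC) ltac:(by rewrite dC).
Qed.
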